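(* Let $n\ge 1$, let $\mathbb{F}\in\{\mathbb{R},\mathbb{C}\}$, let $\mathcal{A}\subseteq\mathfrak{su}(2^n)$ be a set of $s$ elements that are linearly independent over $\mathbb{F}$, let $\mathfrak{g}=\langle\mathcal{A}\rangle_{\mathrm{Lie},\mathbb{F}}$, and let $\mathfrak{c}$ be the center of $\mathfrak{g}$. Then $\dim_{\mathbb{F}}(\mathfrak{c})\le s$.
   Context: $\mathfrak{su}(N)=\{H\in\mathbb{C}^{N\times N}: H^\dagger=-H,\ \mathrm{tr}(H)=0\}$. $\langle\mathcal{A}\rangle_{\mathrm{Lie},\mathbb{F}}$ denotes the Lie algebra over $\mathbb{F}$, with bracket $[A,B]=AB-BA$, generated by $\mathcal{A}$, i.e. the $\mathbb{F}$-linear span (inside $\mathbb{C}^{2^n\times 2^n}$) of all elements of $\mathcal{A}$ and all their nested commutators. The center of $\mathfrak{g}$ is $\{A\in\mathfrak{g}:[A,B]=0\ \forall B\in\mathfrak{g}\}$. *)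

(* Defs.v *)
From HB Require Import structures.
From mathcomp Require Import all_boot all_order all_algebra.
From mathcomp Require Import finmap complex.
From mathcomp Require Import boolp classical_sets reals.

Set Implicit Arguments.
Unset Strict Implicit.
Unset Printing Implicit Defensive.

Import Order.TTheory GRing.Theory Num.Theory.

Local Open Scope classical_set_scope.
Local Open Scope ring_scope.
Local Open Scope sesquilinear_scope.

(* The F-linear span of an arbitrary set of vectors of a finite-dimensional
   space, as a library subspace.  The defining property determines the subspace
   uniquely, and span_setP shows that it is always attained, so the default
   value 0 is never used. *)
Section SpanSet.
Variables (F : fieldType) (V : vectType F).

Definition is_span (P : set V) (U : {vspace V}) : Prop :=
  forall x, x \in U <->
    exists2 X : seq V, (forall v, v \in X -> P v) & x \in <<X>>%VS.

Definition span_set (P : set V) : {vspace V} := xget 0%VS (is_span P).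

Lemma span_setP (P : set V) : is_span P (span_set P).
Proof.
rewrite /span_set; apply: (@xgetPex _ 0%VS (is_span P)).
pose Q (d : nat) := `[< exists2 X : seq V,
  (forall v, v \in X -> P v) & \dim <<X>>%VS = d >].
have exQ : exists d, Q d.
  by exists 0%N; apply/asboolP; exists [::]; rewrite // span_nil dimv0.
have ubQ d : Q d -> (d <= \dim {:V})%N.
  by move=> /asboolP[X _ <-]; apply: dimvS; apply: subvf.
case: (ex_maxnP exQ ubQ) => d /asboolP[X XP dX] maxd.
exists <<X>>%VS => x; split=> [xX|[Y YP xY]]; first by exists X.
have eqX : (<<X>> = <<X ++ Y>>)%VS.
  apply/eqP; rewrite eqEdim span_cat addvSl /= -span_cat dX maxd //.
  apply/asboolP; exists (X ++ Y) => // v.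
  by rewrite mem_cat => /orP[/XP|/YP].
by rewrite eqX span_cat; apply: subvP (addvSr _ _) _ xY.
Qed.

End SpanSet.

Variant ground := Reals | Complexes.

Section GroundField.
Variable R : realType.

Definition ground_field (k : ground) : fieldType :=
  match k with Reals => R | Complexes => R[i] end.

Definition ground_emb (k : ground) : ground_field k -> R[i] :=
  match k with Reals => real_complex R | Complexes => idfun end.

Lemma ground_emb_is_zmod_morphism k : zmod_morphism (@ground_emb k).
Proof. by case: k => // x y; rewrite /= raddfB. Qed.

Lemma ground_emb_is_monoid_morphism k : monoid_morphism (@ground_emb k).
Proof. by case: k; split=> //= x y; rewrite rmorphM. Qed.

HB.instance Definition _ k :=
  GRing.isZmodMorphism.Build (ground_field k) R[i] (@ground_emb k)
    (@ground_emb_is_zmod_morphism k).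
HB.instance Definition _ k :=
  GRing.isMonoidMorphism.Build (ground_field k) R[i] (@ground_emb k)
    (@ground_emb_is_monoid_morphism k).

End GroundField.

(* Complex N x N matrices with scalars restricted to the ground field: the
   carrier and the addition are those of 'M[R[i]]_N, but the library's linear
   algebra (free, span, \dim) is taken over R or over R[i] according to k. *)
Definition cmx (R : realType) (k : ground) (N : nat) : Type := 'M[R[i]]_N.

Section CMx.
Variables (R : realType) (k : ground) (N : nat).
Local Notation F := (ground_field R k).
Local Notation V := (cmx R k N).

HB.instance Definition _ := GRing.Zmodule.copy V 'M[R[i]]_N.

Definition cmx_scale (a : F) (A : V) : V := ground_emb a *: (A : 'M[R[i]]_N).

Lemma cmx_scalerA a b (A : V) :
  cmx_scale a (cmx_scale b A) = cmx_scale (a * b) A.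
Proof. by rewrite /cmx_scale scalerA rmorphM. Qed.
Lemma cmx_scale1r : left_id 1 cmx_scale.
Proof. by move=> A; rewrite /cmx_scale rmorph1 scale1r. Qed.
Lemma cmx_scalerDr : right_distributive cmx_scale +%R.
Proof. by move=> a A B; rewrite /cmx_scale scalerDr. Qed.
Lemma cmx_scalerDl (A : V) : {morph cmx_scale^~ A : a b / a + b}.
Proof. by move=> a b; rewrite /cmx_scale rmorphD scalerDl. Qed.

HB.instance Definition _ := GRing.Zmodule_isLmodule.Build F V
  cmx_scalerA cmx_scale1r cmx_scalerDr cmx_scalerDl.

End CMx.

Lemma cmx_scaleE R k N (a : ground_field R k) (A : cmx R k N) :
  a *: A = ground_emb a *: (A : 'M[R[i]]_N) :> 'M[R[i]]_N.
Proof. by []. Qed.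

Definition cmx_dim (k : ground) (N : nat) : nat :=
  match k with Reals => N * N + N * N | Complexes => N * N end.

Definition cmx_coords R (k : ground) N :
    cmx R k N -> 'rV[ground_field R k]_(cmx_dim k N) :=
  match k with
  | Reals => fun A : 'M[R[i]]_N =>
      row_mx (mxvec (map_mx (@complex.Re R) A)) (mxvec (map_mx (@complex.Im R) A))
  | Complexes => fun A : 'M[R[i]]_N => mxvec A
  end.

Lemma cmx_coords_linear R k N : linear (@cmx_coords R k N).
Proof.
case: k => a A B; last exact: (linearP mxvec).
rewrite /= scale_row_mx add_row_mx -!linearP /=; congr row_mx; congr mxvec.
  by apply/matrixP=> i j; rewrite !mxE /=; case: (A i j) (B i j) => [x y] [z t];
     rewrite /= mul0r subr0.
by apply/matrixP=> i j; rewrite !mxE /=; case: (A i j) (B i j) => [x y] [z t];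
   rewrite /= mul0r addr0.
Qed.

Lemma cmx_coords_bij R k N : bijective (@cmx_coords R k N).
Proof.
case: k => /=; last by exists vec_mx; [exact: mxvecK | exact: vec_mxK].
exists (fun v : 'rV_(N * N + N * N) =>
  (\matrix_(i, j) Complex (vec_mx (lsubmx v) i j) (vec_mx (rsubmx v) i j))
    : cmx R Reals N).
  move=> A; apply/matrixP=> i j.
  by rewrite mxE row_mxKl row_mxKr !mxvecK !mxE; case: (A i j).
move=> v; rewrite -[RHS]hsubmxK; congr row_mx;
  by rewrite -[RHS]vec_mxK; congr mxvec; apply/matrixP=> i j; rewrite !mxE.
Qed.

HB.instance Definition _ R k N :=
  Lmodule_hasFinDim.Build (ground_field R k) (cmx R k N)
    (exist2 _ _ (@cmx_coords R k N)
       (@cmx_coords_linear R k N) (@cmx_coords_bij R k N)).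

Definition su (R : realType) (N : nat) : set 'M[R[i]]_N :=
  [set H | H ^t* = - H /\ \tr H = 0].
Arguments su : clear implicits.

Section LieAlgebra.
Variables (R : realType) (k : ground) (N : nat).
Local Notation V := (cmx R k N).

Definition lie_bracket (A B : V) : V :=
  (A : 'M[R[i]]_N) *m (B : 'M[R[i]]_N) - (B : 'M[R[i]]_N) *m (A : 'M[R[i]]_N).

Inductive nested_commutator (S : set V) : set V :=
| nested_gen A of S A : nested_commutator S A
| nested_bracket A B of nested_commutator S A & nested_commutator S B :
    nested_commutator S (lie_bracket A B).

Definition lie_generated (S : set V) : {vspace V} :=
  span_set (nested_commutator S).

(* The set below is already a subspace, see mem_lie_center; span_set only
   turns it into an element of {vspace V}. *)
Definition lie_center (g : {vspace V}) : {vspace V} :=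
  span_set [set A | A \in g /\ forall B, B \in g -> lie_bracket A B = 0].

Lemma lie_bracket_linearl (B : V) : linear (lie_bracket^~ B).
Proof.
move=> a A C; rewrite /lie_bracket.
change (((ground_emb a *: (A : 'M[R[i]]_N) + (C : 'M[R[i]]_N)) *m B
  - B *m (ground_emb a *: (A : 'M[R[i]]_N) + (C : 'M[R[i]]_N)))
  = ground_emb a *: ((A : 'M[R[i]]_N) *m B - B *m A)
    + ((C : 'M[R[i]]_N) *m B - B *m C)).
by rewrite mulmxDl mulmxDr -scalemxAl -scalemxAr scalerBr opprD addrACA.
Qed.

Lemma mem_lie_center (g : {vspace V}) A :
  A \in lie_center g <->
  (A \in g /\ forall B, B \in g -> lie_bracket A B = 0).
Proof.
split=> [/span_setP[X XP AX]|Ac]; last first.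
  apply/span_setP; exists [:: A]; last by rewrite span_seq1 memv_line.
  by move=> v; rewrite inE => /eqP->.
split; first by apply: subvP AX; apply/span_subvP => v /XP[].
move=> B Bg.
pose f := GRing.isLinear.Build _ _ _ _ (lie_bracket^~ B) (lie_bracket_linearl B).
pose L : {linear V -> V} := HB.pack (lie_bracket^~ B) f.
have : A \in lker (linfun L).
  apply: subvP AX; apply/span_subvP => v /XP[_ /(_ _ Bg) vB].
  by rewrite memv_ker lfunE /= vB.
by rewrite memv_ker lfunE /= => /eqP.
Qed.

End LieAlgebra.

(* Main.v *)
Require Import Defs.
From mathcomp Require Import all_boot all_order all_algebra.
From mathcomp Require Import finmap complex.
From mathcomp Require Import boolp classical_sets reals.

(** Write g for the Lie algebra generated by A and D for the span of the brackets
    of nested commutators.  Then g is contained in span(A) + D, so it suffices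
    that the center meets D trivially.  If Z is central, then Z^* commutes with
    the generators because these are skew-Hermitian, hence with every nested
    commutator, and so tr([X, Y] Z^* ) = tr([X, Y Z^* ]) = 0 for nested commutators
    X and Y.  If moreover Z lies in D, then tr(Z Z^* ) = 0, that is, Z = 0. *)

Import Order.TTheory GRing.Theory Num.Theory.

Local Open Scope classical_set_scope.
Local Open Scope ring_scope.
Local Open Scope sesquilinear_scope.

Section SpanSetTheory.
Context {F : fieldType} {V : vectType F}.
Implicit Types (P : set V) (U : {vspace V}).

Lemma mem_span_set P v : P v -> v \in span_set P.
Proof.
move=> Pv; apply/span_setP; exists [:: v]; last by rewrite span_seq1 memv_line.
by move=> w; rewrite inE => /eqP->.
Qed.

Lemma span_set_subv P U :
  (forall v, P v -> v \in U) -> (span_set P <= U)%VS.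
Proof.
move=> PU; apply/subvP => v /span_setP[X XP vX].
by apply: subvP vX; apply/span_subvP => w /XP /PU.
Qed.

Lemma span_set_ind P (Q : V -> Prop) :
    Q 0 -> (forall u v, Q u -> Q v -> Q (u + v)) ->
    (forall a v, Q v -> Q (a *: v)) -> (forall v, P v -> Q v) ->
  forall v, v \in span_set P -> Q v.
Proof.
move=> Q0 QD QZ PQ v /span_setP[X XP /(coord_span (X := in_tuple X)) ->].
by apply: big_ind => // i _; apply/QZ/PQ/XP/mem_nth.
Qed.

End SpanSetTheory.

(** The trace is the sum of the squared moduli of the entries, all nonnegative. *)
Lemma mxtrace_mul_conj_eq0 (C : numClosedFieldType) m n (Z : 'M[C]_(m, n)) :
  \tr (Z *m Z ^t*) = 0 -> Z = 0.
Proof.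
move=> trZ0; apply/matrixP => i j; rewrite [RHS]mxE; apply/eqP.
have sum_ge0 l : 0 <= \sum_j Z l j * (Z l j)^*.
  by apply: sumr_ge0 => *; apply: mul_conjC_ge0.
have: \sum_l \sum_j Z l j * (Z l j)^* = 0.
  rewrite -[RHS]trZ0; apply: eq_bigr => l _; rewrite !mxE.
  by apply: eq_bigr => c _; rewrite !mxE.
move/psumr_eq0P => /(_ (fun l _ => sum_ge0 l)) /(_ i isT).
move/psumr_eq0P => /(_ (fun c _ => mul_conjC_ge0 _)) /(_ j isT) /eqP.
by rewrite mul_conjC_eq0.
Qed.

(** Taking adjoints reverses both products, and the sign from [H ^t* = - H] cancels. *)
Lemma comm_mx_conj_skew (C : numClosedFieldType) n (H Z : 'M[C]_n) :
  H ^t* = - H -> comm_mx H Z -> comm_mx H (Z ^t*).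
Proof.
move=> Hskew HZ; have := congr1 (fun M : 'M[C]_n => M ^t*) HZ.
rewrite /comm_mx !trmx_mul !map_mxM Hskew mulmxN mulNmx => /oppr_inj.
by move->.
Qed.

Section LieCenter.
Context {R : realType} {k : ground} {N : nat}.
Local Notation V := (cmx R k N).
Implicit Types (S : set V) (X Y : V) (W : 'M[R[i]]_N).

Lemma lie_bracket_eq0 X Y :
  lie_bracket X Y = 0 -> comm_mx (X : 'M[R[i]]_N) (Y : 'M[R[i]]_N).
Proof. by move/eqP; rewrite subr_eq0 => /eqP. Qed.

(** The commutant of [W] is closed under products and differences, hence under brackets. *)
Lemma comm_mx_nested S W :
    (forall X, S X -> comm_mx (X : 'M_N) W) ->
  forall X, nested_commutator S X -> comm_mx (X : 'M_N) W.
Proof.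
move=> SW X; elim=> {X} [X /SW //|X Y _ XW _ YW].
by apply: comm_mx_sym; apply: comm_mxB; apply: comm_mxM; apply: comm_mx_sym.
Qed.

Lemma mxtrace_lie_bracket_mul X Y W :
  comm_mx (X : 'M_N) W -> \tr ((lie_bracket X Y : 'M_N) *m W) = 0.
Proof.
move=> XW; rewrite mulmxBl raddfB /= -!mulmxA XW mxtrace_mulC -mulmxA.
exact: subrr.
Qed.

(** By bilinearity of the bracket this is the derived algebra of [lie_generated S]. *)
Definition bracket_span S : {vspace V} :=
  span_set [set Z | exists X Y, [/\ nested_commutator S X,
                                    nested_commutator S Y & Z = lie_bracket X Y]].

(** A nested commutator is either a generator or a bracket of two nested commutators. *)
Lemma lie_generated_sub S :
  (lie_generated S <= span_set S + bracket_span S)%VS.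
Proof.
apply: span_set_subv => _ [X SX|X Y SX SY].
  by apply: (subvP (addvSl _ _)); apply: mem_span_set.
apply: (subvP (addvSr _ _)); apply: mem_span_set.
by exists X, Y.
Qed.

Lemma bracket_span_sub S : (bracket_span S <= lie_generated S)%VS.
Proof.
apply: span_set_subv => _ [X [Y [SX SY ->]]].
by apply: mem_span_set; apply: nested_bracket.
Qed.

Lemma lie_center_sub (g : {vspace V}) : (lie_center g <= g)%VS.
Proof. by apply/subvP => X /mem_lie_center[]. Qed.

Lemma lie_center_bracket_span S :
    (forall H, S H -> (H : 'M[R[i]]_N) ^t* = - (H : 'M_N)) ->
  (lie_center (lie_generated S) :&: bracket_span S = 0)%VS.
Proof.
move=> Sskew; apply/eqP; rewrite -subv0; apply/subvP => Z.
rewrite memv_cap memv0 => /andP[/mem_lie_center[_ Zc] ZD].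
apply/eqP/(@mxtrace_mul_conj_eq0 R[i]).
(* Over the complex numbers [Z] need not be skew-Hermitian, so adjoints are taken against the
   generators, which are. *)
have ZcommS X : nested_commutator S X -> comm_mx (X : 'M_N) ((Z : 'M_N) ^t*).
  apply: comm_mx_nested => H SH; apply: comm_mx_conj_skew (Sskew H SH) _.
  apply/comm_mx_sym/lie_bracket_eq0/Zc/mem_span_set; exact: nested_gen.
(* With the adjoint of [Z] frozen as [W], the trace condition is linear in the other factor and can
   be checked on brackets. *)
move: ((Z : 'M_N) ^t*) ZcommS => W WcommS.
pose Q X := \tr ((X : 'M_N) *m W) = 0.
apply: (span_set_ind _ Q) ZD => [|X Y X0 Y0|a X X0|_ [X [Y [SX _ ->]]]]; rewrite /Q.
- by rewrite mul0mx mxtrace0.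
- by rewrite mulmxDl mxtraceD X0 Y0 addr0.
- by rewrite cmx_scaleE -scalemxAl mxtraceZ X0 mulr0.
- by apply: mxtrace_lie_bracket_mul; apply: WcommS.
Qed.

Lemma dim_lie_center_le S :
    (forall H, S H -> (H : 'M[R[i]]_N) ^t* = - (H : 'M_N)) ->
  (\dim (lie_center (lie_generated S)) <= \dim (span_set S))%N.
Proof.
move=> /lie_center_bracket_span capD0.
(* With c the center and D the bracket span, dim c + dim D = dim (c + D) <= dim g <= dim span(S) +
   dim D. *)
rewrite -(leq_add2r (\dim (bracket_span S))) -(dimv_disjoint_sum capD0).
apply: leq_trans (dimv_add_leqif _ _).1; apply: dimvS.
apply: subv_trans (lie_generated_sub S).
by rewrite subv_add lie_center_sub bracket_span_sub.
Qed.

End LieCenter.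

Theorem theorem1 (R : realType) (n s : nat) (k : ground)
    (A : {fset cmx R k (2 ^ n)})
    (n_ge1 : (1 <= n)%N)
    (A_su : forall H, H \in A -> su R (2 ^ n) H)
    (A_card : #|` A| = s)
    (A_free : free (enum_fset A)) :
  (\dim (lie_center (lie_generated [set H | H \in A])) <= s)%N.
Proof.
apply: leq_trans (dim_lie_center_le _ _) _ => [H /A_su[]//|].
rewrite -A_card; apply: leq_trans (dim_span (enum_fset A)).
by apply/dimvS/span_set_subv => H; apply: memv_span.
Qed.
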